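(* Let $k\ge 2$ be an integer and let $G$ be a $k$-regular graph with $n$ vertices. Then $G$ is simply balanceable if and only if one of the following conditions holds: (1) $k=2$ and $n\not\equiv 2 \pmod 4$; (2) $k\ge 3$, $n\equiv 0\pmod 4$, and $\alpha(G)\ge n/4$.
   Context: All graphs are finite, simple and undirected. $\alpha(G)$ denotes the independence number of $G$ (the maximum size of a set of pairwise nonadjacent vertices). A graph $G=(V,E)$ is called simply balanceable if there exists an independent set $I$ in $G$ such that $\lfloor |E|/2\rfloor \le \sum_{x\in I} d(x) \le \lceil |E|/2\rceil$, where $d(x)$ is the degree of $x$ in $G$. *)

(* Defs.v *)
From mathcomp Require Import all_boot.
Set Implicit Arguments.
Unset Strict Implicit.
Unset Printing Implicit Defensive.

Record sgraph := SGraph {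
  vertex :> finType;
  adj : rel vertex;
  adj_sym : symmetric adj;
  adj_irrefl : irreflexive adj
}.

Definition edges (G : sgraph) : {set {set G}} :=
  [set [set x; y] | x in G, y in G & adj x y].

Definition degree (G : sgraph) (x : G) : nat := #|[set y | adj x y]|.

Definition regular (k : nat) (G : sgraph) : Prop :=
  forall x : G, degree x = k.

Definition independent (G : sgraph) (I : {set G}) : bool :=
  [forall x in I, forall y in I, ~~ adj x y].

Definition alpha (G : sgraph) : nat :=
  \max_(I : {set G} | independent I) #|I|.

Definition simply_balanceable (G : sgraph) : Prop :=
  exists I : {set G}, independent I /\
    #|edges G|./2 <= \sum_(x in I) degree x <= uphalf #|edges G|.

(* Main.v *)
Require Import Defs.
From mathcomp Require Import all_boot.
From mathcomp Require Import zify.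

(** In a [k]-regular graph [2 |E| = k n], and an independent set of size [m] has
    degree sum [k m], so [G] is simply balanceable iff some [m <= alpha G]
    satisfies [|E|/2 <= k m <= |E|/2] up to rounding. If [|E|] is even this says
    [n = 4 m]; if [|E|] is odd it says [4 k m = k n + 2] or [4 k m = k n - 2],
    so [k] divides [2]. For [k = 2] the required [m] is always at most
    [n / 3 <= alpha G], because the closed neighbourhoods of a maximum
    independent set cover the graph. *)

Section Graph.
Variable G : sgraph.
Implicit Types (x y : G) (I J : {set G}).

Lemma in_edges x y : ([set x; y] \in edges G) = adj x y.
Proof.
apply/imset2P/idP => [[a b _]|xy]; last by exists x y; rewrite ?inE.
rewrite inE => /andP[_ ab] /setP xyE.
(* Membership of [x] and [y] in the pair of [a] and [b] leaves four cases; that of [a] and [b] in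
   the other pair rules out [x = y]. *)
have := xyE a; have := xyE b; have := xyE x; have := xyE y.
have nab : a != b by apply: contraTneq ab => ->; rewrite adj_irrefl.
rewrite !inE !eqxx !orbT /= => /esym/orP[]/eqP-> /esym/orP[]/eqP->;
  rewrite ?orbb ?ab // 1?adj_sym ?ab //.
- by move=> /eqP eba; rewrite eba eqxx in nab.
- by move=> _ /eqP eba; rewrite eba eqxx in nab.
Qed.

Lemma card_edge (e : {set G}) : e \in edges G -> #|e| = 2.
Proof.
case/imset2P=> a b _; rewrite inE => /andP[_ ab] ->; rewrite cards2.
by have -> : a != b by apply: contraTneq ab => ->; rewrite adj_irrefl.
Qed.

(** The map sending [y] to [[set x; y]] is a bijection from the neighbours of [x] onto the edges at
    [x]. *)
Lemma card_edges_at x : #|[set e in edges G | x \in e]| = degree x.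
Proof.
rewrite /degree -(card_in_imset (f := fun y => [set x; y])) => [|y z].
  congr #|pred_of_set _|; apply/setP => e; rewrite inE.
  apply/andP/imsetP => [[]|[y]]; last first.
    by rewrite inE => xy ->; rewrite in_edges xy !inE eqxx.
  case/imset2P=> a b _; rewrite inE => /andP[_ ab] ->.
  rewrite !inE => /orP[]/eqP->; first by exists b; rewrite ?inE.
  by exists a; rewrite ?inE 1?adj_sym // setUC.
rewrite !inE => xy _ /setP/(_ y); rewrite !inE eqxx orbT.
case/esym/orP=> /eqP // yx; move: xy; by rewrite yx adj_irrefl.
Qed.

(** Both sides count incident vertex-edge pairs, grouped by vertex or by edge. *)
Lemma handshake : \sum_(x : G) degree x = 2 * #|edges G|.
Proof.
transitivity (\sum_(e in edges G) #|e|); last first.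
  by rewrite (eq_bigr _ card_edge) sum_nat_const mulnC.
rewrite (eq_bigr (fun x => \sum_(e in edges G | x \in e) 1)) => [|x _]; last first.
  by rewrite -card_edges_at -sum1_card; apply: eq_bigl => e; rewrite inE.
rewrite (exchange_big_dep (mem (edges G))) /= => [|x e _ /andP[] //].
apply: eq_bigr => e Ee; rewrite -sum1_card.
by apply: eq_bigl => x; rewrite Ee.
Qed.

Lemma independentS I J : I \subset J -> independent J -> independent I.
Proof.
move=> /subsetP sIJ /forall_inP indJ; apply/forall_inP => x /sIJ/indJ/forall_inP Jx.
by apply/forall_inP => y /sIJ/Jx.
Qed.

Lemma independent_le_alpha I : independent I -> #|I| <= alpha G.
Proof. exact: (leq_bigmax_cond (F := fun I : {set G} => #|I|)). Qed.

Lemma independent_alpha : exists2 I : {set G}, independent I & #|I| = alpha G.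
Proof.
have ind0 : independent (set0 : {set G}) by apply/forall_inP => x; rewrite inE.
rewrite /alpha (bigmax_eq_arg _ ind0).
by case: arg_maxnP => // I indI _; exists I.
Qed.

(** Subsets of a maximum independent set realise every smaller size, so the bound on [m] is the only
    constraint on the degree sum [k * m]. *)
Lemma independent_of_card m :
  m <= alpha G -> exists2 I : {set G}, independent I & #|I| = m.
Proof.
have [J indJ <-] := independent_alpha => le_mJ.
exists [set x in take m (enum J)].
  apply: independentS indJ; apply/subsetP => x; rewrite inE => /mem_take.
  by rewrite mem_enum.
by rewrite cardsE (card_uniqP _) ?take_uniq ?enum_uniq // size_takel -?cardE.
Qed.

Lemma independentU1 I x :
  independent I -> (forall y, y \in I -> ~~ adj x y) -> independent (x |: I).
Proof.
move=> /forall_inP indI xI; apply/forall_inP => y /setU1P[->|Iy];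
  apply/forall_inP => z /setU1P[->|Iz]; rewrite ?adj_irrefl ?xI //.
- by rewrite adj_sym xI.
- exact: (forall_inP (indI y Iy)).
Qed.

Lemma regular_alpha k : regular k G -> #|G| <= k.+1 * alpha G.
Proof.
move=> regG; have [I indI alphaI] := independent_alpha.
have coverI : \bigcup_(x in I) (x |: [set y | adj x y]) = setT.
  (* An uncovered [y] could be added to [I], giving an independent set larger than [alpha G]. *)
  apply/setP => y; rewrite inE; apply: contraTT isT => /bigcupP ncov.
  have nIy : y \notin I.
    by apply/negP => Iy; apply: ncov; exists y; rewrite // setU11.
  have /independent_le_alpha : independent (y |: I).
    apply: independentU1 => // x Ix; apply/negP => yx; apply: ncov.
    by exists x; rewrite // !inE adj_sym yx orbT.
  by rewrite cardsU1 nIy alphaI ltnn.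
rewrite -cardsT -coverI -alphaI mulnC -sum_nat_const.
elim/big_ind2: _ => [|a A b B leA leB|x _]; first by rewrite cards0.
  exact: leq_trans (leq_card_setU A B).1 (leq_add leA leB).
rewrite cardsU1 inE adj_irrefl.
by have := regG x; rewrite /degree => ->.
Qed.

Lemma regular_simply_balanceable k : regular k G ->
  simply_balanceable G <->
  exists2 m, m <= alpha G & #|edges G|./2 <= k * m <= uphalf #|edges G|.
Proof.
move=> regG.
have sum_deg I : \sum_(x in I) degree x = k * #|I|.
  by rewrite (eq_bigr _ (fun x _ => regG x)) sum_nat_const mulnC.
split=> [[I [indI]] | [m /independent_of_card[I indI <-]]].
  by rewrite sum_deg; exists #|I|; rewrite ?independent_le_alpha.
by exists I; rewrite sum_deg.
Qed.

End Graph.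

Theorem theorem3p2 (k n : nat) (G : sgraph) (hk : 2 <= k)
    (hreg : regular k G) (hn : #|G| = n) :
  simply_balanceable G <->
    (k = 2 /\ n <> 2 %[mod 4]) \/
    [/\ 3 <= k, n = 0 %[mod 4] & n <= 4 * alpha G].
Proof.
have edgesE : 2 * #|edges G| = k * n.
  rewrite -handshake (eq_bigr _ (fun x _ => hreg x)) sum_nat_const mulnC.
  by rewrite -hn.
have le_alpha := regular_alpha _ _ hreg; rewrite hn in le_alpha.
apply: (iff_trans (regular_simply_balanceable _ _ hreg)).
set e := #|edges G| in edgesE *; set a := alpha G in le_alpha *.
split=> [[m le_ma bal] | [[k2 n4] | [k3 n4 le_na]]].
- case: (ltngtP k 2) => [|k3|k2]; first lia.
    (* An odd edge count would make [k * (4 * m - n)] equal to 2 or -2 over the integers, impossible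
       for [k >= 3]. *)
    right; have n4m : n = 4 * m by nia.
    by split=> //; lia.
  by left; subst k; split=> //; lia.
(* Here [e = n], and the witness is [n / 4] rounded to the nearest integer: [q] for [n = 4q] or
   [4q + 1], and [q + 1] for [n = 4q + 3]. It is at most [a] because [n <= 3 * a]. *)
- subst k; exists (n.+1 %/ 4); lia.
- have [m n4m] : exists m, n = 4 * m by exists (n %/ 4); lia.
  exists m; first lia.
  have -> : e = 2 * (k * m) by nia.
  lia.
Qed.
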